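(* Let $\mathfrak{D}_n$ denote the set of desarrangements of length $n$ and let $\mu=\sqrt{1+2t(1-2s)+t^{2}}$. Then \[ \sum_{n=0}^{\infty}\sum_{\pi\in\mathfrak{D}_{n}}s^{\mathrm{pk}(\pi)}t^{\mathrm{des}(\pi)}\frac{x^{n}}{n!} =\frac{\mu(3-s-2t)\cosh\left(\frac{\mu x}{2}\right)-(1-s+(3-s)t-2t^{2})\sinh\left(\frac{\mu x}{2}\right)-\mu e^{(1-3t)x/2}}{(2-s-2t)\left(\mu\cosh\left(\frac{\mu x}{2}\right)-(1+t)\sinh\left(\frac{\mu x}{2}\right)\right)}. \]
   Context: Permutations $\pi\in\mathfrak{S}_n$ are written in one-line notation $\pi=\pi_1\cdots\pi_n$; $\mathfrak{S}_0$ consists of the empty permutation. An index $i\in[n-1]$ is a descent of $\pi$ if $\pi_i>\pi_{i+1}$, and $\mathrm{des}(\pi)$ counts descents; $i\in[n]$ is an ascent if it is not a descent (so $n$ is always an ascent). A desarrangement is a permutation whose first ascent is even; the empty permutation is a desarrangement. For $i\in\{2,\dots,n-1\}$, $i$ is a peak of $\pi$ if $\pi_{i-1}<\pi_i>\pi_{i+1}$; $\mathrm{pk}(\pi)$ is the number of peaks. The identity is of formal power series in $x$ (the right side is even in $\mu$). *)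

(* Defs.v *)
From mathcomp Require Import all_boot all_order all_fingroup all_algebra.

Set Implicit Arguments.
Unset Strict Implicit.
Unset Printing Implicit Defensive.

Import GRing.Theory.

Section PermutationStatistics.

Variables (n : nat) (p : 'S_n).

(* Indices and values are shifted from {0, ..., n-1} to [n] = {1, ..., n};
   [letter i] is p_i for 1 <= i <= n, and a junk value otherwise. *)
Definition one_line : seq nat := [seq (p i).+1 | i : 'I_n].

Definition letter (i : nat) : nat := nth 0 one_line i.-1.

Definition is_descent (i : nat) : bool :=
  (1 <= i <= n.-1) && (letter i > letter i.+1).

Definition is_ascent (i : nat) : bool := (1 <= i <= n) && ~~ is_descent i.

Definition is_peak (i : nat) : bool :=
  (2 <= i <= n.-1) && (letter i.-1 < letter i) && (letter i > letter i.+1).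

Definition des : nat := count is_descent (iota 1 n).

Definition pk : nat := count is_peak (iota 1 n).

(* The least ascent; the default value 0 is only reached when n = 0. *)
Definition first_ascent : nat := head 0 [seq i <- iota 1 n | is_ascent i].

Definition is_desarrangement : bool := (n == 0) || ~~ odd first_ascent.

End PermutationStatistics.

Local Open Scope ring_scope.

(* A formal power series is its sequence of coefficients; equality of series
   is pointwise equality [=1]. *)
Definition fps (K : fieldType) := nat -> K.

Declare Scope fps_scope.
Delimit Scope fps_scope with FPS.
Bind Scope fps_scope with fps.

Section FormalPowerSeries.

Variable K : fieldType.
Implicit Types (f g : fps K) (a : K).

Definition fps_one : fps K := fun n => (n == 0%N)%:R.

Definition fps_add f g : fps K := fun n => f n + g n.

Definition fps_sub f g : fps K := fun n => f n - g n.

Definition fps_scale a f : fps K := fun n => a * f n.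

Definition fps_mul f g : fps K :=
  fun n => \sum_(i < n.+1) f i * g (n - i)%N.

(* The coefficients of degree 0, ..., n of 1/f, when f 0 != 0. *)
Fixpoint fps_inv_prefix f (n : nat) : seq K :=
  if n is m.+1 then
    let r := fps_inv_prefix f m in
    rcons r (- (f 0%N)^-1 * \sum_(i < m.+1) r`_i * f (m.+1 - i)%N)
  else [:: (f 0%N)^-1].

Definition fps_inv f : fps K := fun n => (fps_inv_prefix f n)`_n.

Definition fps_div f g : fps K := fps_mul f (fps_inv g).

(* The series e^(ax), cosh(ax), sinh(ax) in the variable x. *)
Definition fps_exp a : fps K := fun n => a ^+ n / n`!%:R.

Definition fps_cosh a : fps K :=
  fps_scale 2^-1 (fps_add (fps_exp a) (fps_exp (- a))).

Definition fps_sinh a : fps K :=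
  fps_scale 2^-1 (fps_sub (fps_exp a) (fps_exp (- a))).

Lemma size_fps_inv_prefix f n : size (fps_inv_prefix f n) = n.+1.
Proof. by elim: n => //= n IHn; rewrite size_rcons IHn. Qed.

Lemma nth_fps_inv_prefix f n i :
  (i <= n)%N -> (fps_inv_prefix f n)`_i = fps_inv f i.
Proof.
elim: n => [|n IHn]; first by rewrite leqn0 => /eqP->.
rewrite leq_eqVlt => /predU1P[-> //|le_i_n].
by rewrite /= nth_rcons size_fps_inv_prefix le_i_n IHn.
Qed.

Lemma fps_mulVf f : f 0%N != 0 -> fps_mul (fps_inv f) f =1 fps_one.
Proof.
move=> f0 [|n]; rewrite /fps_mul /fps_one.
  by rewrite big_ord1 /fps_inv /= mulVf.
rewrite big_ord_recr /= subnn /fps_inv /= nth_rcons size_fps_inv_prefix.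
rewrite ltnn eqxx mulrAC mulNr mulVf // mulN1r.
apply/eqP; rewrite subr_eq0; apply/eqP.
apply: eq_bigr => i _.
by rewrite (nth_fps_inv_prefix f (n := n)) // -ltnS.
Qed.

End FormalPowerSeries.

Notation "f + g" := (fps_add f g) : fps_scope.
Notation "f - g" := (fps_sub f g) : fps_scope.
Notation "a *: f" := (fps_scale a%R f) : fps_scope.
Notation "f * g" := (fps_mul f g) : fps_scope.
Notation "f / g" := (fps_div f g) : fps_scope.

Definition desarrangement_egf (K : fieldType) (s t : K) : fps K :=
  fun n => (\sum_(p : 'S_n | is_desarrangement p) s ^+ pk p * t ^+ des p)
             / n`!%:R.

(* Main.v *)
(* Cutting a permutation at its largest letter, pi = u m v, determines the
   statistics of pi from those of u and v.  Hence the exponential generating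
   functions F of nonempty permutations and G of nonempty desarrangements satisfy
     F' = 1 + (1 + t) F + s t F^2,   G' = G (1 - t + s t F) + t F.
   Put V = mu cosh(mu x/2) - (1 + t) sinh(mu x/2), c = 2 - s - 2t and
   M = mu cosh(mu x/2) + (1 - 3t) sinh(mu x/2) - mu e^((1 - 3t)x/2).
   By the Riccati equation, F V - 2 sinh(mu x/2) satisfies a homogeneous linear
   first order equation with zero initial value, so F V = 2 sinh(mu x/2); the same
   argument then gives c G V = M.  The claim is 1 + G = (c V + M) / (c V). *)

Require Import Defs.
From HB Require Import structures.
From mathcomp Require Import all_boot all_order all_fingroup all_algebra.
From mathcomp Require Import boolp ring.

Set Implicit Arguments.
Unset Strict Implicit.
Unset Printing Implicit Defensive.

Import GRing.Theory.

(** * Statistics as functions of words *)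

(** Arbitrary words are allowed because the two factors around the largest letter of a permutation
    need not be permutations themselves. *)
Fixpoint des_word (w : seq nat) : nat :=
  if w is x :: w' then (if w' is y :: _ then y < x else false) + des_word w'
  else 0.

Fixpoint pk_word (w : seq nat) : nat :=
  if w is x :: w' then
    (if w' is y :: z :: _ then (x < y) && (z < y) else false) + pk_word w'
  else 0.

(* A leading descent shifts the first ascent by one, so it flips its parity. *)
Fixpoint desarr_word (w : seq nat) : bool :=
  if w is x :: w' then
    if w' is y :: _ then (y < x) && ~~ desarr_word w' else false
  else true.

Lemma size_one_line n (p : 'S_n) : size (one_line p) = n.
Proof. by rewrite size_map size_enum_ord. Qed.

Lemma des_wordE w :
  des_word w = count (fun i => (1 <= i <= (size w).-1)
     && (nth 0 w i < nth 0 w i.-1)) (iota 1 (size w)).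
Proof.
elim: w => //= x w IHw; rewrite IHw.
rewrite [iota 2 _](iotaDl 1 1) count_map; case: w {IHw} => //= y w.
congr (_ + (_ + _)); apply: eq_in_count => i.
by rewrite mem_iota; case: i.
Qed.

Lemma pk_wordE w :
  pk_word w = count (fun i => (2 <= i <= (size w).-1)
     && (nth 0 w i.-2 < nth 0 w i.-1) && (nth 0 w i < nth 0 w i.-1))
     (iota 1 (size w)).
Proof.
elim: w => [|x w IHw] //; rewrite [LHS]/= IHw.
case: w {IHw} => [|y [|z w]] //=.
rewrite !add0n; congr (_ + (_ + _)).
rewrite [iota 4 _](iotaDl 1 3) count_map; apply: eq_in_count => i.
by rewrite mem_iota; case: i => [|[|i]].
Qed.

Lemma des_one_line n (p : 'S_n) : des p = des_word (one_line p).
Proof. by rewrite des_wordE size_one_line. Qed.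

Lemma pk_one_line n (p : 'S_n) : pk p = pk_word (one_line p).
Proof. by rewrite pk_wordE size_one_line. Qed.

Lemma desarr_wordE w :
  desarr_word w = (size w == 0) || ~~ odd (head 0
    [seq i <- iota 1 (size w) | (1 <= i <= size w) &&
     ~~ ((1 <= i <= (size w).-1) && (nth 0 w i < nth 0 w i.-1))]).
Proof.
elim: w => //= x w IHw.
case: w IHw => //= y w IHw; set q := (fun i => _ && ~~ _).
case: ltnP => //= yx; rewrite IHw negbK ltnS.
case: andP => [[w_gt0 _] | _] //=; rewrite [iota 3 _](iotaDl 1 2) filter_map.
set r := filter _ _; set r' := filter _ _; have <- : r = r'.
  apply: eq_in_filter => i; rewrite mem_iota => /andP[i_gt1 _].
  by case: i i_gt1 => [|[|i]].
(* Incrementing every entry flips the parity of the head provided the list is nonempty. It contains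
   the last position of the shorter word, which is always an ascent. *)
suff: r != [::] by case: r => //= i r _; rewrite negbK.
by rewrite -has_filter; apply/hasP; exists (size w).+1;
  rewrite ?mem_iota ?ltnS ?w_gt0 ?leqnn ?ltnn.
Qed.

Lemma desarr_one_line n (p : 'S_n) :
  is_desarrangement p = desarr_word (one_line p).
Proof. by rewrite desarr_wordE size_one_line. Qed.

(** * Cutting at the largest letter, and relabelling *)

Section WordStatistics.

Implicit Types (u v w : seq nat) (m x : nat).

(** The step into [m] is never a descent; the step out of it always is, and it exists when [v] is
    nonempty. *)
Lemma des_word_split u m v : all (ltn^~ m) u -> all (ltn^~ m) v ->
  des_word (u ++ m :: v) = des_word u + des_word v + (v != [::]).
Proof.
move=> um vm; elim: u um => [_|x u IHu /= /andP[xm um]].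
  by case: v vm => //= y v /andP[-> _]; rewrite addnC.
rewrite IHu // !addnA; congr (_ + _ + _ + _).
by case: u um {IHu} => //= _; rewrite ltnNge ltnW.
Qed.

(** [m] is a peak exactly when it has neighbours on both sides, and a neighbour of [m] is never a
    peak. *)
Lemma pk_word_split u m v : all (ltn^~ m) u -> all (ltn^~ m) v ->
  pk_word (u ++ m :: v) =
    pk_word u + pk_word v + ((u != [::]) && (v != [::])).
Proof.
move=> um vm; elim: u um => [_|x u IHu /= /andP[xm um]].
  case: v vm => [|y [|z v]] //= /andP[ym _].
  by rewrite [m < y]ltnNge (ltnW ym) addn0.
rewrite IHu //; case: u um {IHu} => [_|y [|z u]] /=.
- by case: v vm => [|y v] //= /andP[ym _]; rewrite xm ym !add0n addn0 addnC.
- by move=> /andP[ym _]; rewrite [m < y]ltnNge (ltnW ym) andbF.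
by rewrite !addnA.
Qed.

(** If [u] is nonempty, its last position is an ascent with or without [m] after it, so the first
    ascent lies in [u]. If [u] is empty, [m] is a leading descent or the whole word. *)
Lemma desarr_word_split u m v : all (ltn^~ m) u -> all (ltn^~ m) v ->
  desarr_word (u ++ m :: v) =
    if u is [::] then (v != [::]) && ~~ desarr_word v else desarr_word u.
Proof.
move=> um vm; elim: u um => [_|x u IHu /= /andP[xm um]].
  by case: v vm => //= y v /andP[-> _].
by rewrite IHu //; case: u um {IHu} => //= _; rewrite ltnNge ltnW.
Qed.

Variable f : nat -> nat.

Lemma des_word_map w : {in w &, {mono f : x y / x < y}} ->
  des_word (map f w) = des_word w.
Proof.
elim: w => //= x w IHw fw; rewrite IHw; last first.
  by apply: sub_in2 fw => z zw; rewrite inE zw orbT.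
by case: w fw {IHw} => //= y w fw; rewrite fw // !inE eqxx ?orbT.
Qed.

Lemma pk_word_map w : {in w &, {mono f : x y / x < y}} ->
  pk_word (map f w) = pk_word w.
Proof.
elim: w => //= x w IHw fw; rewrite IHw; last first.
  by apply: sub_in2 fw => z zw; rewrite inE zw orbT.
by case: w fw {IHw} => //= y [|z w] // fw; rewrite /= !fw // !inE eqxx ?orbT.
Qed.

Lemma desarr_word_map w : {in w &, {mono f : x y / x < y}} ->
  desarr_word (map f w) = desarr_word w.
Proof.
elim: w => //= x w IHw fw; rewrite IHw; last first.
  by apply: sub_in2 fw => z zw; rewrite inE zw orbT.
by case: w fw {IHw} => //= y w fw; rewrite fw // !inE eqxx ?orbT.
Qed.

End WordStatistics.

Local Open Scope ring_scope.

(** * The ring of formal power series *)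

Section FpsRing.

Variable K : fieldType.
Implicit Types (f g h : fps K) (p q : {poly K}).

Definition fps_zero : fps K := fun=> 0.

Definition fps_opp f : fps K := fun n => - f n.

Definition fps_trunc n f : {poly K} := \poly_(i < n.+1) f i.

Lemma coef_fps_trunc n f i : (i <= n)%N -> (fps_trunc n f)`_i = f i.
Proof. by move=> le_in; rewrite coef_poly ltnS le_in. Qed.

(** Truncation imports the ring laws of polynomials: a product up to degree n sees its factors up to
    degree n only. *)
Lemma fps_mul_coef n p q f g :
    (forall i, (i <= n)%N -> f i = p`_i) ->
    (forall i, (i <= n)%N -> g i = q`_i) ->
  forall i, (i <= n)%N -> fps_mul f g i = (p * q)`_i.
Proof.
move=> fp gq i le_in; rewrite coefM; apply: eq_bigr => j _.
by rewrite fp ?gq // (leq_trans _ le_in) ?leq_subr // -ltnS.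
Qed.

Lemma fps_mulA : associative (@fps_mul K).
Proof.
move=> f g h; apply/funext => n.
have tr := fun f i le_in => esym (@coef_fps_trunc n f i le_in).
rewrite (fps_mul_coef (tr f) (fps_mul_coef (tr g) (tr h))) //.
by rewrite mulrA (fps_mul_coef (fps_mul_coef (tr f) (tr g)) (tr h)).
Qed.

Lemma fps_mulC : commutative (@fps_mul K).
Proof.
move=> f g; apply/funext => n.
have tr := fun f i le_in => esym (@coef_fps_trunc n f i le_in).
by rewrite (fps_mul_coef (tr f) (tr g)) // mulrC (fps_mul_coef (tr g) (tr f)).
Qed.

Lemma fps_mul1 : left_id (@fps_one K) (@fps_mul K).
Proof.
move=> f; apply/funext => n; rewrite /fps_mul big_ord_recl /= mul1r subn0.
by rewrite big1 ?addr0 // => i _; rewrite mul0r.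
Qed.

Lemma fps_mulDl : left_distributive (@fps_mul K) (@fps_add K).
Proof.
move=> f g h; apply/funext => n; rewrite /fps_add /fps_mul -big_split /=.
by apply: eq_bigr => i _; rewrite mulrDl.
Qed.

Lemma fps_addA : associative (@fps_add K).
Proof. by move=> f g h; apply/funext => n; apply: addrA. Qed.

Lemma fps_addC : commutative (@fps_add K).
Proof. by move=> f g; apply/funext => n; apply: addrC. Qed.

Lemma fps_add0 : left_id fps_zero (@fps_add K).
Proof. by move=> f; apply/funext => n; apply: add0r. Qed.

Lemma fps_addN : left_inverse fps_zero fps_opp (@fps_add K).
Proof. by move=> f; apply/funext => n; apply: addNr. Qed.

End FpsRing.

(** Equality of series is undecidable, so these structures rest on classical axioms. *)
HB.instance Definition _ (K : fieldType) := gen_eqMixin (fps K).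
HB.instance Definition _ (K : fieldType) := gen_choiceMixin (fps K).
HB.instance Definition _ (K : fieldType) :=
  GRing.isZmodule.Build (fps K) (@fps_addA K) (@fps_addC K) (@fps_add0 K)
    (@fps_addN K).

Lemma fps_one_neq0 (K : fieldType) : @fps_one K != 0.
Proof. by apply/eqP => /(congr1 (@^~ 0%N))/eqP; rewrite oner_eq0. Qed.

HB.instance Definition _ (K : fieldType) :=
  GRing.Zmodule_isComNzRing.Build (fps K) (@fps_mulA K) (@fps_mulC K)
    (@fps_mul1 K) (@fps_mulDl K) (@fps_one_neq0 K).

(** * Derivation, exponentials and linear differential equations *)

Section FpsTheory.

Variable K : fieldType.
Implicit Types (f g h : fps K) (a b : K).

(** Registered below as a ring morphism, so that [ring] computes with scalar coefficients. *)
Definition fps_const a : fps K := fun n => a * (n == 0%N)%:R.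

Lemma fps_const_is_zmod : zmod_morphism fps_const.
Proof. by move=> a b; apply/funext => n; apply: mulrBl. Qed.

Lemma fps_scaleE a f : fps_scale a f = fps_const a * f.
Proof.
apply/funext => n; rewrite [RHS]big_ord_recl subn0 /fps_const mulr1.
by rewrite big1 ?addr0 // => i _; rewrite mulr0 mul0r.
Qed.

Lemma fps_const_is_monoid : monoid_morphism fps_const.
Proof.
split=> [|a b]; first by apply/funext => n; apply: mul1r.
by rewrite -fps_scaleE; apply/funext => n; rewrite /fps_scale /fps_const mulrA.
Qed.

HB.instance Definition _ :=
  GRing.isZmodMorphism.Build K (fps K) fps_const fps_const_is_zmod.
HB.instance Definition _ :=
  GRing.isMonoidMorphism.Build K (fps K) fps_const fps_const_is_monoid.

Definition fps_deriv f : fps K := fun n => f n.+1 *+ n.+1.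

Lemma fps_derivB f g : fps_deriv (f - g)%R = fps_deriv f - fps_deriv g.
Proof. by apply/funext => n; apply: mulrnBl. Qed.

Lemma fps_derivD f g : fps_deriv (f + g)%R = fps_deriv f + fps_deriv g.
Proof. by apply/funext => n; apply: mulrnDl. Qed.

(** The Leibniz rule of polynomials, applied to truncations at n + 1 since the derivative shifts
    degrees by one. *)
Lemma fps_derivM f g :
  fps_deriv (f * g)%R = fps_deriv f * g + f * fps_deriv g.
Proof.
apply/funext => n.
have tr (h : fps K) i : (i <= n.+1)%N -> h i = (fps_trunc n.+1 h)`_i.
  by move=> le_in; rewrite coef_fps_trunc.
have tr_n (h : fps K) i : (i <= n)%N -> h i = (fps_trunc n.+1 h)`_i.
  by move/leqW/tr.
have dtr (h : fps K) i : (i <= n)%N -> fps_deriv h i = (fps_trunc n.+1 h)^`()`_i.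
  by move=> le_in; rewrite coef_deriv coef_fps_trunc.
rewrite {1}/fps_deriv [(f * g) _](fps_mul_coef (tr f) (tr g)) //.
rewrite -coef_deriv derivM coefD.
by congr (_ + _); [rewrite -(fps_mul_coef (dtr f) (tr_n g))
                  |rewrite -(fps_mul_coef (tr_n f) (dtr g))].
Qed.

Lemma fps_deriv_const a : fps_deriv (fps_const a) = 0.
Proof. by apply/funext => n; rewrite /fps_deriv /fps_const mulr0 mul0rn. Qed.

Hypothesis charK0 : [pchar K] =i pred0.

Lemma natr_neq0 n : (n.+1%:R != 0 :> K).
Proof. by have /pcharf0P-> := charK0. Qed.

Lemma fps_deriv_exp a : fps_deriv (fps_exp a) = fps_const a * fps_exp a.
Proof.
rewrite -fps_scaleE; apply/funext => n.
rewrite /fps_deriv /fps_scale /fps_exp -[LHS]mulr_natr factS natrM exprS.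
rewrite invfM -!mulrA; congr (_ * (_ * _)).
by rewrite mulrCA mulVf ?natr_neq0 ?mulr1.
Qed.

Lemma fps_coshE a :
  fps_cosh a = fps_const 2^-1 * (fps_exp a + fps_exp (- a))%R.
Proof. exact: fps_scaleE. Qed.

Lemma fps_sinhE a :
  fps_sinh a = fps_const 2^-1 * (fps_exp a - fps_exp (- a))%R.
Proof. exact: fps_scaleE. Qed.

Lemma fps_deriv_cosh a :
  fps_deriv (fps_cosh a) = fps_const a * fps_sinh a.
Proof.
rewrite fps_coshE fps_sinhE fps_derivM fps_deriv_const fps_derivD.
by rewrite !fps_deriv_exp // rmorphN; ring.
Qed.

Lemma fps_deriv_sinh a :
  fps_deriv (fps_sinh a) = fps_const a * fps_cosh a.
Proof.
rewrite fps_coshE fps_sinhE fps_derivM fps_deriv_const fps_derivB.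
by rewrite !fps_deriv_exp // rmorphN; ring.
Qed.

Lemma fps_cosh0 a : fps_cosh a 0%N = 1.
Proof.
rewrite /fps_cosh /fps_scale /fps_add /fps_exp !expr0 fact0 divr1.
by rewrite mulVf // natr_neq0.
Qed.

Lemma fps_sinh0 a : fps_sinh a 0%N = 0.
Proof. by rewrite /fps_sinh /fps_scale /fps_sub /fps_exp subrr mulr0. Qed.

(** Uniqueness principle: degree n of [h * f] involves [f] up to degree n, which vanishes by
    induction; characteristic 0 allows division by n + 1. *)
Lemma fps_linear_ode_eq0 f h : f 0%N = 0 -> fps_deriv f = h * f -> f = 0.
Proof.
move=> f0 df; apply/funext => n; elim/ltn_ind: n => -[//|n] IHn.
have /eqP := congr1 (@^~ n) df; rewrite [(h * f) n]big1 => [|i _].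
  by rewrite /fps_deriv -mulr_natr mulf_eq0 (negPf (natr_neq0 n)) orbF => /eqP.
by rewrite IHn ?mulr0 // ltnS leq_subr.
Qed.

Lemma fps_div_eq f g h : g 0%N != 0 -> h * g = f -> h = fps_div f g.
Proof.
move=> g0 <-; change (h = h * g * fps_inv g).
have gV : fps_inv g * g = 1 by apply/funext/fps_mulVf.
by rewrite -mulrA [g * _]mulrC gV mulr1.
Qed.

End FpsTheory.

(** * Sums over the orderings of a set of letters *)

Section WordSum.

Variable K : fieldType.

(* For such a function, the sum over all orderings of a set of letters depends
   only on the cardinality of the set. *)
Definition order_invariant (a : seq nat -> K) :=
  forall (f : nat -> nat) w, {in w &, {mono f : x y / (x < y)%N}} ->
    a (map f w) = a w.

Definition perm_sum (a : seq nat -> K) n : K := \sum_(p : 'S_n) a (one_line p).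

(** Distinct entries make [p] recoverable from the rearranged list, and [tuple_permP] reaches every
    rearrangement. *)
Lemma permutations_perm (T : eqType) n (x : T) (r : seq T) : size r = n -> uniq r ->
  perm_eq (permutations r) [seq [seq nth x r (p i) | i : 'I_n] | p : 'S_n].
Proof.
move=> sz_r Ur; apply: uniq_perm; first exact: permutations_uniq.
- rewrite map_inj_uniq ?enum_uniq // => p q /eq_in_map pq; apply/permP => i.
  apply/val_inj/eqP; rewrite -(nth_uniq x _ _ Ur) ?sz_r ?ltn_ord //.
  by rewrite (pq i) ?mem_enum.
move=> w; rewrite mem_permutations.
pose tr : n.-tuple T := tcast sz_r (in_tuple r).
have val_tr : tr = r :> seq T by rewrite val_tcast.
have nth_tr i : tnth tr i = nth x r i by rewrite (tnth_nth x) val_tr.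
rewrite -{1}val_tr; apply/tuple_permP/mapP => [[p ->]|[p _ ->]]; exists p.
- by rewrite mem_enum.
- by apply: eq_map => i; rewrite nth_tr.
- by apply: eq_map => i; rewrite nth_tr.
Qed.

(** [enum A] is increasing, so each ordering of [A] is an order-preserving relabelling of a
    permutation. *)
Lemma sum_permutations_set N (a : seq nat -> K) (A : {set 'I_N}) :
    order_invariant a ->
  \sum_(w <- permutations (enum A)) a (map val w) = perm_sum a #|A|.
Proof.
(* The empty ordinal type has no [ord0] to serve as default, hence a separate case. *)
move=> a_inv; case: N A => [|N] A.
  have -> : A = set0 by apply/setP=> -[].
  rewrite enum_set0 cards0 /perm_sum big_seq1.
  rewrite (bigD1 1%g) //= big1 ?addr0 => [|p /eqP[]]; last first.
    by apply/permP => -[].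
  by congr (a _); apply/esym/size0nil; rewrite size_map size_enum_ord.
have szA : size (enum A) = #|A| by rewrite cardE.
rewrite (perm_big _ (permutations_perm ord0 szA (enum_uniq _))) big_map.
rewrite big_enum /=; apply: eq_bigr => p _.
(* Letters of [one_line] start at 1, hence the predecessor. *)
pose f i := val (nth ord0 (enum A) i.-1).
have -> : [seq val i | i <- [seq nth ord0 (enum A) (p i) | i : 'I_#|A|]]
           = map f (one_line p).
  by rewrite -!map_comp; apply: eq_map.
apply: a_inv => _ _ /mapP[i _ ->] /mapP[j _ ->]; rewrite /f /= ltnS.
have sA : sorted ltn (map val (enum A)).
  have := iota_ltn_sorted 0 N.+1; rewrite -val_enum_ord.
  apply: (subseq_sorted ltn_trans); apply: map_subseq.
  by rewrite {1}/enum_mem -enumT; apply: filter_subseq.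
rewrite -!(nth_map ord0 0%N (@nat_of_ord N.+1)) ?szA //.
by apply: (Order.POrderTheory.lt_sorted_ltn_nth 0%N sA); rewrite inE size_map szA.
Qed.

Lemma mem_permutations_enum (T : finType) (A : {set T}) w :
  (w \in permutations (enum A)) = uniq w && ([set x in w] == A).
Proof.
rewrite mem_permutations; apply/idP/andP => [wA | [Uw /eqP <-]].
  rewrite (perm_uniq wA) enum_uniq; split=> //; apply/eqP/setP => x.
  by rewrite inE (perm_mem wA) mem_enum.
by apply: uniq_perm; rewrite ?enum_uniq // => x; rewrite mem_enum inE.
Qed.

(** An ordering of all letters amounts to a free choice of the set [B] of letters before [m], an
    ordering of [B], and one of the remaining letters. *)
Lemma permutations_split (T : finType) (m : T) :
  perm_eq (permutations (enum [set: T]))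
    [seq uv.1 ++ m :: uv.2 | B <- enum (powerset [set~ m]),
      uv <- [seq (u, v) | u <- permutations (enum B),
                           v <- permutations (enum (~: (m |: B)))]].
Proof.
apply: uniq_perm; first exact: permutations_uniq.
(* The cut is unique because [m] is absent from both prefixes. *)
- have cat_inj (u1 v1 u2 v2 : seq T) : m \notin u1 -> m \notin u2 ->
      u1 ++ m :: v1 = u2 ++ m :: v2 -> u1 = u2 /\ v1 = v2.
    elim: u1 u2 => [|x u1 IHu] [|y u2] //=.
    - by move=> _ _ [->].
    - by rewrite inE negb_or => _ /andP[/eqP ? _] [].
    - by rewrite inE negb_or => /andP[/eqP ? _] _ [] /esym.
    rewrite !inE !negb_or => /andP[_ mu1] /andP[_ mu2] [-> /IHu].
    by case=> // -> ->.
  apply: allpairs_uniq_dep; first exact: enum_uniq.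
    move=> B _; apply: allpairs_uniq; rewrite ?permutations_uniq //.
    by move=> [? ?] [? ?].
  move=> x y /allpairsPdep[B1 [uv1 [B1m /allpairsP[[u1 v1] /= [u1B _ ->]] ->]]].
  move=> /allpairsPdep[B2 [uv2 [B2m /allpairsP[[u2 v2] /= [u2B _ ->]] ->]]] /=.
  move: B1m B2m u1B u2B; rewrite !mem_enum !mem_permutations_enum !powersetE.
  move=> B1m B2m /andP[_ /eqP eB1] /andP[_ /eqP eB2] /cat_inj[].
  - by apply/negP => mu; have:= subsetP B1m m; rewrite -eB1 !inE eqxx mu => /(_ isT).
  - by apply/negP => mu; have:= subsetP B2m m; rewrite -eB2 !inE eqxx mu => /(_ isT).
  by rewrite -eB1 -eB2 => -> ->.
move=> w; rewrite mem_permutations_enum; apply/andP/allpairsPdep.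
  move=> [Uw /eqP wT]; have mw : m \in w.
    by have:= in_setT m; rewrite -wT inE.
  case/splitPr: mw Uw wT => u v; rewrite uniq_catC /= mem_cat negb_or -andbA.
  rewrite cat_uniq => /and5P[mv mu Uv vu Uu] wT.
  exists [set x in u], (u, v); split=> //.
    rewrite mem_enum powersetE; apply/subsetP => x; rewrite !inE.
    by apply: contraL => /eqP->.
  apply/allpairsP; exists (u, v); rewrite !mem_permutations_enum Uu Uv eqxx.
  split=> //=; apply/eqP/setP => x; rewrite !inE.
  have := in_setT x; rewrite -wT !inE mem_cat inE.
  case: eqP => [->|_] /=; first by rewrite (negPf mv).
  case xu: (x \in u) => //= _.
  by apply/negP => xv; case/hasP: vu; exists x.
move=> [B [uv [Bm /allpairsP[[u v] /= [uB vB ->]] ->]]] /=.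
move: Bm uB vB; rewrite mem_enum powersetE !mem_permutations_enum.
move=> /subsetP Bm /andP[Uu /eqP eB] /andP[Uv /eqP/setP eC].
have vE x : (x \in v) = (x != m) && (x \notin u).
  by have := eC x; rewrite -eB !inE negb_or.
have mu : m \notin u.
  by apply/negP => mu; have:= Bm m; rewrite -eB !inE eqxx mu => /(_ isT).
split; last by apply/eqP/setP => x; rewrite !inE mem_cat inE vE;
   case: (x == m); case: (x \in u).
rewrite uniq_catC /= mem_cat negb_or vE eqxx mu /= cat_uniq Uu Uv /= andbT.
by apply/hasPn => x xu; rewrite vE negb_and negbK orbC xu.
Qed.

Lemma sum_powerset_card (T : finType) (m : T) (F : nat -> K) n :
  #|T| = n.+1 ->
  \sum_(B in powerset [set~ m]) F #|B| = \sum_(k < n.+1) F k *+ 'C(n, k).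
Proof.
move=> cT; have cm : #|[set~ m]| = n by rewrite cardsC1 cT.
have le_n B : B \in powerset [set~ m] -> (#|B| < n.+1)%N.
  by rewrite powersetE ltnS -cm => /subset_leq_card.
(* Subsets are grouped by cardinality; [inord] is faithful as [B] has at most n elements. *)
rewrite (partition_big (fun B : {set T} => inord #|B| : 'I_n.+1) predT) //=.
apply: eq_bigr => k _.
have -> : 'C(n, k) = 'C(#|[set~ m]|, k) by rewrite cm.
rewrite -cards_draws -sumr_const.
apply: eq_big => [B|B /andP[Bm /eqP <-]]; last by rewrite inordK ?le_n.
rewrite inE -powersetE; apply: andb_id2l => Bm.
by rewrite -val_eqE /= inordK ?le_n // powersetE.
Qed.

(** Bundling the invariance lets a list of pairs describe how a weight splits at a cut. *)
Record word_fun := WordFun {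
  word_fun_val :> seq nat -> K;
  word_funP : order_invariant word_fun_val }.

(** After the cut at the largest letter, the two sides are ordered independently, and by invariance
    each contributes through its size alone. *)
Lemma perm_sum_split (c : word_fun) (L : seq (word_fun * word_fun)) n :
    (forall u m v, all (ltn^~ m) u -> all (ltn^~ m) v ->
       c (u ++ m :: v) = \sum_(ab <- L) ab.1 u * ab.2 v) ->
  perm_sum c n.+1 =
    \sum_(ab <- L) \sum_(k < n.+1)
      (perm_sum ab.1 k * perm_sum ab.2 (n - k)) *+ 'C(n, k).
Proof.
move=> c_split; pose m : 'I_n.+1 := ord_max.
have -> : perm_sum c n.+1 = perm_sum c #|[set: 'I_n.+1]|.
  by rewrite cardsT card_ord.
rewrite -sum_permutations_set; last exact: word_funP.
rewrite (perm_big _ (permutations_split m)) big_allpairs_dep big_enum /=.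
under [RHS]eq_bigr => ab _ do
  rewrite -(sum_powerset_card m (fun k => perm_sum ab.1 k
              * perm_sum ab.2 (n - k))) ?card_ord //.
rewrite [RHS]exchange_big; apply: eq_bigr => B; rewrite powersetE => Bm.
rewrite big_allpairs_dep /=.
have mB : m \notin B.
  by apply/negP => /(subsetP Bm); rewrite !inE eqxx.
have cardC : #|~: (m |: B)| = (n - #|B|)%N.
  have := cardsC (m |: B); rewrite cardsU1 mB card_ord => /eqP.
  by rewrite add1n addSn eqSS => /eqP/(canRL (addKn _)).
(* Since [m] is [ord_max], avoiding it means lying below it, as [c_split] demands. *)
have lt_m u : m \notin u -> all (ltn^~ m) (map val u).
  move=> mu; apply/allP => _ /mapP[i iu ->] /=.
  rewrite ltn_neqAle -ltnS ltn_ord andbT.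
  apply: contra mu => /eqP im; suff <- : i = m by [].
  exact: val_inj.
under [LHS]eq_big_seq => u.
  rewrite mem_permutations_enum => /andP[_ /eqP uB].
  under eq_big_seq => v.
    rewrite mem_permutations_enum => /andP[_ /eqP vB].
    rewrite map_cat /= c_split; first over.
    - by apply: lt_m; move: mB; rewrite -uB inE.
    - by apply: lt_m; have := setU11 m B; rewrite -[m |: B]setCK -vB !inE.
  rewrite exchange_big; under eq_bigr => ab _.
    rewrite -big_distrr sum_permutations_set ?cardC; last exact: word_funP.
    over.
  over.
rewrite exchange_big; apply: eq_bigr => ab _.
by rewrite -big_distrl sum_permutations_set //; apply: word_funP.
Qed.

End WordSum.

(** * Exponential generating functions of word functions *)

Section WordEgf.

Variable K : fieldType.
Hypothesis charK0 : [pchar K] =i pred0.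
Implicit Types (a b c : word_fun K) (k : K).

Definition word_egf a : fps K := fun n => perm_sum a n / n`!%:R.

Lemma word_egf0 a : word_egf a 0%N = a [::].
Proof.
rewrite /word_egf /perm_sum divr1 (eq_bigr (fun=> a [::])) => [|p _].
  by rewrite sumr_const card_Sn.
by congr (a _); apply/size0nil; rewrite size_one_line.
Qed.

Lemma word_funZ_proof k a : order_invariant (fun w => k * a w).
Proof. by move=> f w fw; rewrite word_funP. Qed.

Definition word_funZ k a := WordFun (word_funZ_proof k a).

Lemma word_egfZ k a : word_egf (word_funZ k a) = fps_const k * word_egf a.
Proof.
rewrite -fps_scaleE; apply/funext => n.
by rewrite /word_egf /perm_sum -mulr_sumr -mulrA.
Qed.

Lemma word_fun_nil_proof : order_invariant (fun w => (w == [::])%:R : K).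
Proof. by move=> f []. Qed.

Definition word_fun_nil := WordFun word_fun_nil_proof.

Lemma word_egf_nil : word_egf word_fun_nil = 1.
Proof.
apply/funext => -[|n]; rewrite /word_egf /perm_sum /=.
  rewrite (eq_bigr (fun=> 1)) => [|p _]; last first.
    by rewrite -size_eq0 size_one_line.
  by rewrite sumr_const card_Sn divr1.
rewrite big1 ?mul0r // => p _.
by rewrite -size_eq0 size_one_line.
Qed.

(** Binomial convolution becomes a product of series; the derivative accounts for the removed
    largest letter. *)
Lemma fps_deriv_word_egf c (L : seq (word_fun K * word_fun K)) :
    (forall u m v, all (ltn^~ m) u -> all (ltn^~ m) v ->
       c (u ++ m :: v) = \sum_(ab <- L) ab.1 u * ab.2 v) ->
  fps_deriv (word_egf c) = \sum_(ab <- L) word_egf ab.1 * word_egf ab.2.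
Proof.
have fact_neq0 j : j`!%:R != 0 :> K.
  by rewrite -(prednK (fact_gt0 j)) natr_neq0.
move=> c_split; apply/funext => n.
have -> : (\sum_(ab <- L) word_egf ab.1 * word_egf ab.2 : fps K) n
        = \sum_(ab <- L) fps_mul (word_egf ab.1) (word_egf ab.2) n.
  by apply: (big_morph (fun f : fps K => f n)).
rewrite /fps_deriv /word_egf (perm_sum_split n c_split) -[LHS]mulr_natr -mulrA.
rewrite factS natrM invfM mulrAC mulVf ?natr_neq0 // mul1r mulr_suml.
apply: eq_bigr => ab _; rewrite mulr_suml; apply: eq_bigr => k _.
rewrite -[X in X / _]mulr_natr -(bin_fact (ltnSE (ltn_ord k))) !natrM.
have bin_neq0 : 'C(n, k)%:R != 0 :> K.
  have : (0 < 'C(n, k))%N by rewrite bin_gt0 -ltnS.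
  by case: 'C(n, k) => // j _; apply: natr_neq0.
by field; rewrite bin_neq0 !fact_neq0.
Qed.

End WordEgf.

(** * Differential equations for [F] and [G] *)

Section Desarrangements.

Variables (K : fieldType) (s t : K).
Hypothesis charK0 : [pchar K] =i pred0.

Definition word_weight (w : seq nat) : K := s ^+ pk_word w * t ^+ des_word w.

Lemma word_weight_invariant : order_invariant word_weight.
Proof. by move=> f w fw; rewrite /word_weight pk_word_map ?des_word_map. Qed.

Lemma word_weight_nil : word_weight [::] = 1.
Proof. exact: mulr1. Qed.

Lemma word_weight_split u m v : all (ltn^~ m) u -> all (ltn^~ m) v ->
  word_weight (u ++ m :: v) =
    s ^+ ((u != [::]) && (v != [::])) * t ^+ (v != [::])
    * word_weight u * word_weight v.
Proof.
move=> um vm; rewrite /word_weight pk_word_split // des_word_split // !exprD.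
ring.
Qed.

Lemma perm_weight_proof :
  order_invariant (fun w => (w != [::])%:R * word_weight w).
Proof. by move=> f w fw; rewrite word_weight_invariant //; case: w fw. Qed.

Definition perm_weight := WordFun perm_weight_proof.

Lemma desarr_weight_proof :
  order_invariant (fun w => ((w != [::]) && desarr_word w)%:R * word_weight w).
Proof.
move=> f w fw; rewrite word_weight_invariant // desarr_word_map //.
by case: w fw.
Qed.

Definition desarr_weight := WordFun desarr_weight_proof.

Let F : fps K := word_egf perm_weight.
Let G : fps K := word_egf desarr_weight.

Lemma fps_deriv_perm_egf :
  fps_deriv F = 1 + (1 + fps_const t) * F + fps_const (s * t) * F ^+ 2.
Proof.
pose e := word_fun_nil K.
(* The pairs correspond to: both sides empty, [v] empty, [u] empty (a descent after [m]), neither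
   empty (a descent and a peak). *)
rewrite /F (@fps_deriv_word_egf _ charK0 _
  [:: (e, e); (perm_weight, e); (word_funZ t e, perm_weight);
      (word_funZ (s * t) perm_weight, perm_weight)]).
  by rewrite !big_cons big_nil /= !word_egfZ !word_egf_nil; ring.
move=> u m v um vm; rewrite !big_cons big_nil /= word_weight_split //.
have -> : u ++ m :: v != [::] by case: (u).
have [->|_] := eqVneq u [::]; have [->|_] := eqVneq v [::];
  by rewrite /= ?word_weight_nil; ring.
Qed.

Lemma fps_deriv_desarr_egf :
  fps_deriv G = G * (1 - fps_const t + fps_const (s * t) * F)
                + fps_const t * F.
Proof.
pose e := word_fun_nil K.
(* With [u] empty, [v] must be a nonempty non-desarrangement, which gives t (F - G) and hence two
   pairs. Otherwise [u] is a desarrangement. Both sides empty contributes nothing. *)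
rewrite /F /G (@fps_deriv_word_egf _ charK0 _
  [:: (desarr_weight, e); (word_funZ t e, perm_weight);
      (word_funZ (- t) e, desarr_weight);
      (word_funZ (s * t) desarr_weight, perm_weight)]).
  by rewrite !big_cons big_nil /= !word_egfZ !word_egf_nil; ring.
move=> u m v um vm; rewrite !big_cons big_nil /= word_weight_split //.
have -> : u ++ m :: v != [::] by case: (u).
have -> : desarr_word (u ++ m :: v) =
    if u == [::] then (v != [::]) && ~~ desarr_word v else desarr_word u.
  by rewrite desarr_word_split //; case: (u).
have [->|_] := eqVneq u [::]; have [->|_] := eqVneq v [::];
  rewrite /= ?word_weight_nil; try ring.
by case: desarr_word => /=; ring.
Qed.

(** The 1 is the empty desarrangement, which [G] leaves out. *)
Lemma desarrangement_egfE : desarrangement_egf s t = 1 + G.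
Proof.
apply/funext => n; rewrite -(word_egf_nil K).
change (desarrangement_egf s t n = word_egf (word_fun_nil K) n + G n).
rewrite /desarrangement_egf /G /word_egf -mulrDl -big_split big_mkcond /=.
congr (_ / _); apply: eq_bigr => p _.
rewrite desarr_one_line des_one_line pk_one_line /word_weight.
case: (one_line p) => [|x w] /=; first by rewrite mul0r addr0 mulr1.
by case: ifP; rewrite ?mul1r ?mul0r add0r.
Qed.

(** * Closed forms of [F] and [G] *)

Variable mu : K.
Hypothesis mu_sqrt : mu ^+ 2 = 1 + 2 * t * (1 - 2 * s) + t ^+ 2.

Let C : fps K := fps_cosh (mu / 2).
Let S : fps K := fps_sinh (mu / 2).
Let E : fps K := fps_exp ((1 - 3 * t) / 2).
Let V := fps_const mu * C - fps_const (1 + t) * S.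
Let M := fps_const mu * C + fps_const (1 - 3 * t) * S - fps_const mu * E.
Let c := 2 - s - 2 * t.

(* In terms of the halves nu and tau, the identities below have integer
   coefficients and hence hold in any commutative ring. *)
Let nu := mu / 2.
Let tau := (1 + t) / 2.

Let two_neq0 : 2 != 0 :> K. Proof. exact: natr_neq0. Qed.

Let mu_nu : mu = 2 * nu. Proof. by rewrite /nu mulrC divfK. Qed.

Let t_tau : t = 2 * tau - 1.
Proof. by rewrite /tau mulrC divfK // addrC addKr. Qed.

Let nu_sq : nu ^+ 2 = tau ^+ 2 - s * (2 * tau - 1).
Proof.
apply: (mulfI two_neq0); apply: (mulfI two_neq0).
have -> : 2 * (2 * nu ^+ 2) = mu ^+ 2 by rewrite mu_nu; ring.
by rewrite mu_sqrt t_tau; ring.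
Qed.

Let dV : fps_deriv V = fps_const nu * (fps_const mu * S - fps_const (1 + t) * C).
Proof.
rewrite fps_derivB !fps_derivM !fps_deriv_const fps_deriv_cosh //.
by rewrite fps_deriv_sinh // -/nu -/C -/S; ring.
Qed.

Lemma perm_egf_formula : F * V = 2 * S.
Proof.
apply/eqP; rewrite -subr_eq0; apply/eqP.
(* The quadratic term of the Riccati equation dictates s t F; the summand tau comes from V' + tau V
   = 2 (nu^2 - tau^2) S. *)
apply: (@fps_linear_ode_eq0 _ charK0 _
         (fps_const (s * t) * F + fps_const tau)%R).
  change (fps_mul F V 0%N - fps_mul 2 S 0%N = 0).
  rewrite /fps_mul !big_ord1 /= /S fps_sinh0 mulr0 /F word_egf0 /=.
  by rewrite !mul0r subr0.
have d2 : fps_deriv (2 : fps K) = 0.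
  by rewrite -(rmorph_nat (@fps_const K)) fps_deriv_const.
rewrite fps_derivB !fps_derivM dV d2 fps_deriv_perm_egf /S fps_deriv_sinh //.
rewrite -/S -/C -/nu; apply/eqP; rewrite -subr_eq0; apply/eqP.
(* What remains is a multiple of the relation [nu_sq]. *)
transitivity (2 * F * S * fps_const (nu ^+ 2 - (tau ^+ 2 - s * (2 * tau - 1)))).
  by rewrite /V mu_nu t_tau; ring.
by rewrite nu_sq subrr rmorph0 mulr0.
Qed.

Lemma desarr_egf_formula : fps_const c * G * V = M.
Proof.
have t_e : (1 - 3 * t) / 2 = 2 - 3 * tau.
  by apply: (mulIf two_neq0); rewrite divfK // t_tau; ring.
apply/eqP; rewrite -subr_eq0; apply/eqP.
(* The coefficient is the exponent of [E], so that the terms in [E] cancel. *)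
apply: (@fps_linear_ode_eq0 _ charK0 _ (fps_const (2 - 3 * tau))).
  change (fps_mul (fps_mul (fps_const c) G) V 0%N
    - (fps_mul (fps_const mu) C 0%N + fps_mul (fps_const (1 - 3 * t)) S 0%N
        - fps_mul (fps_const mu) E 0%N) = 0).
  rewrite /fps_mul !big_ord1 /= /S /C fps_sinh0 fps_cosh0 // /G word_egf0 /=.
  by rewrite /E /fps_exp expr0 divr1 !mul0r mulr0 mul0r mulr0 addr0 subrr subr0.
have dM : fps_deriv M =
    fps_const nu * (fps_const mu * S + fps_const (1 - 3 * t) * C)
    - fps_const mu * fps_const (2 - 3 * tau) * E.
  rewrite fps_derivB fps_derivD !fps_derivM !fps_deriv_const fps_deriv_cosh //.
  by rewrite fps_deriv_sinh // fps_deriv_exp // -/nu -/C -/S -/E t_e; ring.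
rewrite fps_derivB !fps_derivM dV dM fps_deriv_const fps_deriv_desarr_egf.
apply/eqP; rewrite -subr_eq0; apply/eqP.
(* The first cofactor collects the occurrences of F V in c G' V, to be replaced by 2 S; the rest is
   again a multiple of [nu_sq]. *)
transitivity ((F * V - 2 * S) * (fps_const (c * s * t) * G + fps_const (t * c))
  + 2 * (fps_const c * G - 1) * S
    * fps_const (nu ^+ 2 - (tau ^+ 2 - s * (2 * tau - 1)))).
  by rewrite /V /M /c mu_nu t_tau; ring.
by rewrite perm_egf_formula nu_sq !subrr rmorph0 mulr0 mul0r addr0.
Qed.

End Desarrangements.

Theorem theorem2p5 (K : fieldType) (charK0 : [pchar K] =i pred0)
    (s t mu : K)
    (mu_sqrt : mu ^+ 2 = 1 + 2 * t * (1 - 2 * s) + t ^+ 2)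
    (mu_neq0 : mu != 0) (st_neq0 : 2 - s - 2 * t != 0) :
  desarrangement_egf s t =1
    (((mu * (3 - s - 2 * t)) *: fps_cosh (mu / 2)
       - (1 - s + (3 - s) * t - 2 * t ^+ 2) *: fps_sinh (mu / 2)
       - mu *: fps_exp ((1 - 3 * t) / 2))
     / ((2 - s - 2 * t) *:
         (mu *: fps_cosh (mu / 2) - (1 + t) *: fps_sinh (mu / 2))))%FPS.
Proof.
move=> n; apply: (congr1 (@^~ n)); apply: fps_div_eq.
  (* The denominator has constant term c mu. *)
  rewrite /fps_scale /fps_sub fps_cosh0 // fps_sinh0 mulr1 mulr0 subr0.
  exact: mulf_neq0.
have subE (f g : fps K) : fps_sub f g = (f - g)%R by [].
rewrite desarrangement_egfE !fps_scaleE !subE.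
set C := fps_cosh _; set S := fps_sinh _; set E := fps_exp _.
set G := word_egf _; set V := (fps_const mu * C - fps_const (1 + t) * S)%R.
set c := 2 - s - 2 * t.
(* The numerator is c V + M, since 3 - s - 2t = c + 1 and c (1 + t) - (1 - 3t) = 1 - s + (3 - s) t -
   2t^2. *)
transitivity (fps_const c * V + fps_const c * G * V)%R; first by ring.
rewrite desarr_egf_formula // -/C -/S -/E /V /c; ring.
Qed.
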